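(* Let $B$ be a left cancellative left semi-brace such that $G=\mathrm{Ker}(\lambda_{|_E})$. Then $G$ is a skew left brace such that $(G,\circ)$ is a normal subgroup of $(B,\circ)$, the intersection $G\cap E$ is equal to $\{0\}$, for every $e\in E$ the automorphism of $(G,\circ)$ given by $g\mapsto e\circ g\circ e^-$ is also an automorphism of $(G,+)$, and $(B,\circ)$ is the (internal) semidirect product of the normal subgroup $(G,\circ)$ and the subgroup $(E,\circ)$. Conversely, let $A=H\rtimes_\beta F$ be a semidirect product of groups $(H,\circ)$ and $(F,\circ)$, together with a skew left brace structure $(H,+,\circ)$ on $H$ (with multiplicative group the given group $(H,\circ)$) such that $\beta_f\in\mathrm{Aut}(H,+,\circ)$ for all $f\in F$. Then these data give rise to a left cancellative left semi-brace on $A$ (with multiplicative group the group $H\rtimes_\beta F$) such that $\{0\}\times F$ is its set of additive idempotents and $H\times\{0\}$ is equal to the kernel of the action $\lambda_{|_{\{0\}\times F}}$ on this set of idempotents.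
   Context: A left semi-brace is a triple $(B,+,\circ)$ where $(B,+)$ is a semigroup, $(B,\circ)$ is a group and $a\circ(b+c)=a\circ b+a\circ(a^-+c)$ for all $a,b,c\in B$, where $a^-$ is the inverse of $a$ in $(B,\circ)$ and $\circ$ has higher precedence than $+$. It is left cancellative if $(B,+)$ is left cancellative. The neutral element of any group $(B,\circ)$ is denoted by $0$. A skew left brace is a left semi-brace for which $(B,+)$ is a (not necessarily abelian) group. For a left cancellative left semi-brace $B$: $G:=B+0=\{b+0\mid b\in B\}$ is a subgroup of $(B,\circ)$; $E$ is the set of idempotents of $(B,+)$, which is a subgroup of $(B,\circ)$. For $a,b\in B$ put $\lambda_a(b):=a\circ(a^-+b)$; then $a\mapsto\lambda_a$ is a homomorphism $(B,\circ)\to\mathrm{Aut}(B,+)$ and $\lambda_a(E)=E$ for all $a$. Write $\lambda_{|_E}:(B,\circ)\to\mathrm{Aut}(E,+)$, $a\mapsto\lambda_a|_E$, for the induced action on $E$, and $\mathrm{Ker}(\lambda_{|_E})$ for its kernel. The group semidirect product $H\rtimes_\beta F$, for a homomorphism $\beta:F\to\mathrm{Aut}(H,\circ)$, is $H\times F$ with $(h_1,f_1)\circ(h_2,f_2)=(h_1\circ\beta_{f_1}(h_2),f_1\circ f_2)$. *)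

(* Defs.v *)
From HB Require Import structures.
From mathcomp Require Import all_boot.
From mathcomp Require Import boolp classical_sets functions.

Set Implicit Arguments.
Unset Strict Implicit.
Unset Printing Implicit Defensive.

Local Open Scope classical_set_scope.
Local Open Scope group_scope.

(* Throughout, the multiplicative group (B, o) of a left semi-brace is a
   [groupType], so the neutral element usually written 0 is [1 : B]; the
   addition is a separate binary operation [add]. *)

Definition subgroup (B : groupType) (D : set B) : Prop :=
  group_closed (mem D).

(* A left semi-brace structure on a subset [D] of a group, for the operations
   obtained by restriction; [left_semi_brace] is the case [D = setT]. *)
Record left_semi_brace_on (B : groupType) (D : set B) (add : B -> B -> B) :
    Prop := {
  lsb_group : subgroup D;
  lsb_add_closed : {in D &, forall a b, add a b \in D};
  lsb_addA : {in D & &, associative add};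
  lsb_distr : {in D & &, forall a b c,
    a * add b c = add (a * b) (a * add a^-1 c)} }.

Definition additive_group_on (B : Type) (D : set B) (add : B -> B -> B) :
    Prop :=
  exists (zero : B) (opp : B -> B),
    [/\ zero \in D, {in D, forall a, opp a \in D},
        {in D &, forall a b, add a b \in D}
      & [/\ {in D & &, associative add},
            {in D, forall a, add zero a = a /\ add a zero = a}
          & {in D, forall a, add (opp a) a = zero /\ add a (opp a) = zero}]].

Definition skew_left_brace_on (B : groupType) (D : set B)
    (add : B -> B -> B) : Prop :=
  left_semi_brace_on D add /\ additive_group_on D add.

Definition left_semi_brace (B : groupType) (add : B -> B -> B) : Prop :=
  left_semi_brace_on [set: B] add.

Definition skew_left_brace (B : groupType) (add : B -> B -> B) : Prop :=
  skew_left_brace_on [set: B] add.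

(* [right_injective add] says that every translation [b |-> a + b] is
   injective, i.e. that (B, +) is left cancellative. *)
Definition left_cancellative_left_semi_brace (B : groupType)
    (add : B -> B -> B) : Prop :=
  left_semi_brace add /\ right_injective add.

Definition lambda (B : groupType) (add : B -> B -> B) (a b : B) : B :=
  a * add a^-1 b.

(* G = B + 0 *)
Definition right_zero_translates (B : groupType) (add : B -> B -> B) : set B :=
  [set add b 1 | b in [set: B]].

Definition additive_idempotents (B : Type) (add : B -> B -> B) : set B :=
  [set e | add e e = e].

(* Ker (lambda restricted to E), for E the set of additive idempotents *)
Definition ker_lambda_idem (B : groupType) (add : B -> B -> B) : set B :=
  [set a | {in additive_idempotents add, forall e, lambda add a e = e}].

Definition automorphism_on (T : Type) (D : set T) (op : T -> T -> T)
    (phi : T -> T) : Prop :=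
  set_bij D D phi /\ {in D &, {morph phi : x y / op x y}}.

Definition automorphism (T : Type) (op : T -> T -> T) (phi : T -> T) : Prop :=
  automorphism_on [set: T] op phi.

Definition normal_subgroup (B : groupType) (N : set B) : Prop :=
  subgroup N /\ {in N, forall n, forall b : B, b * n * b^-1 \in N}.

Definition internal_semidirect_product (B : groupType) (N K : set B) : Prop :=
  [/\ normal_subgroup N, subgroup K, N `&` K = [set 1]
    & [set n * k | n in N & k in K] = [set: B]].

(* Homomorphisms from F to Aut (H, o). *)
Record aut_hom (F H : groupType) := AutHom {
  aut_fun :> F -> H -> H;
  aut_funP : forall f, automorphism *%g (aut_fun f);
  aut_funM : forall f1 f2 h, aut_fun (f1 * f2) h = aut_fun f1 (aut_fun f2 h) }.

Definition semidirect (F H : groupType) (beta : aut_hom F H) : Type :=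
  (H * F)%type.

Section SemidirectGroup.
Variables (F H : groupType) (beta : aut_hom F H).
Local Notation A := (semidirect beta).

HB.instance Definition _ := Choice.on A.

Definition semidirect_mul (a b : A) : A :=
  (a.1 * beta a.2 b.1, a.2 * b.2).
Definition semidirect_one : A := (1, 1).
Definition semidirect_inv (a : A) : A := (beta a.2^-1 a.1^-1, a.2^-1).

Lemma aut_hom_mulr f : {morph beta f : x y / x * y}.
Proof. by case: (aut_funP beta f) => _ h x y; apply: h; rewrite inE. Qed.

Lemma aut_hom_one f : beta f 1 = 1.
Proof. by apply: (mulgI (beta f 1)); rewrite -aut_hom_mulr !mulg1. Qed.

Lemma aut_hom1 h : beta 1 h = h.
Proof.
case: (aut_funP beta 1) => -[_ inj _] _; apply: inj; rewrite ?inE //.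
by rewrite -aut_funM mulg1.
Qed.

Lemma semidirect_mulA : associative semidirect_mul.
Proof.
move=> a b c; rewrite /semidirect_mul /=.
by rewrite aut_hom_mulr aut_funM !mulgA.
Qed.

Lemma semidirect_mul1 : left_id semidirect_one semidirect_mul.
Proof. by case=> h f; rewrite /semidirect_mul /= aut_hom1 !mul1g. Qed.

Lemma semidirect_mulr1 : right_id semidirect_one semidirect_mul.
Proof. by case=> h f; rewrite /semidirect_mul /= aut_hom_one !mulg1. Qed.

Lemma semidirect_mulV :
  left_inverse semidirect_one semidirect_inv semidirect_mul.
Proof.
case=> h f; rewrite /semidirect_mul /= -aut_hom_mulr !mulVg.
by rewrite aut_hom_one.
Qed.

Lemma semidirect_mulrV :
  right_inverse semidirect_one semidirect_inv semidirect_mul.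
Proof.
case=> h f; rewrite /semidirect_mul /= -aut_funM !mulgV.
by rewrite aut_hom1 mulgV.
Qed.

HB.instance Definition _ := isGroup.Build A semidirect_mulA semidirect_mul1
  semidirect_mulr1 semidirect_mulV semidirect_mulrV.

End SemidirectGroup.

(* Main.v *)
(* Left cancellation makes 0 a left identity for +, so a o b = a + lambda_a(b)
   and the additive idempotents are exactly the left identities.  Hence
   e o b = lambda_e(b) for e in E, while g o e = g + e when g acts trivially
   on E.  If G = Ker(lambda_|E), these two rules give
   e o g o e^- = lambda_e(g) + 0, which is additive in g, and
   b = (b + 0) + lambda_b(0) = (b + 0) o lambda_b(0) gives B = G o E.
   Conversely one puts (h1, f1) + (h2, f2) = (h1 + h2, f2) on H x F. *)

Require Import Defs.
From HB Require Import structures.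
From mathcomp Require Import all_boot.
From mathcomp Require Import boolp classical_sets functions.

Local Open Scope classical_set_scope.
Local Open Scope group_scope.

Set Implicit Arguments.
Unset Strict Implicit.
Unset Printing Implicit Defensive.

(** * The action [lambda] by additive automorphisms *)

Lemma left_semi_brace_distr (B : groupType) (add : B -> B -> B) :
  left_semi_brace add ->
  forall a b c, a * add b c = add (a * b) (lambda add a c).
Proof. by case=> _ _ _ D a b c; apply: D; rewrite inE. Qed.

Lemma left_semi_brace_addA (B : groupType) (add : B -> B -> B) :
  left_semi_brace add -> associative add.
Proof. by case=> _ _ A _ a b c; apply: A; rewrite inE. Qed.

(** Distributivity at a = b = 1 reads 1 + x = 1 + (1 + x); cancel the outer 1. *)
Lemma add1x (B : groupType) (add : B -> B -> B) :
  left_cancellative_left_semi_brace add -> left_id 1 add.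
Proof.
move=> [Hb cB] x; apply: (cB 1).
by have := left_semi_brace_distr Hb 1 1 x; rewrite /lambda invg1 !mul1g.
Qed.

Lemma mulg_addE (B : groupType) (add : B -> B -> B) :
  left_cancellative_left_semi_brace add ->
  forall a b, a * b = add a (lambda add a b).
Proof.
move=> HB a b; rewrite -{1}(add1x HB b).
by rewrite (left_semi_brace_distr HB.1) mulg1.
Qed.

Lemma lambdaD (B : groupType) (add : B -> B -> B) :
  left_semi_brace add -> forall a, {morph lambda add a : b c / add b c}.
Proof.
move=> HB a b c; rewrite {1}/lambda (left_semi_brace_addA HB).
by rewrite (left_semi_brace_distr HB).
Qed.

Lemma lambda1 (B : groupType) (add : B -> B -> B) :
  left_cancellative_left_semi_brace add -> forall b, lambda add 1 b = b.
Proof. by move=> HB b; rewrite /lambda invg1 mul1g (add1x HB). Qed.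

(** Both sides agree after adding a o b on the left: since a o b = a + lambda_a(b), the right-hand
    side becomes a + lambda_a(b + lambda_b(c)) = a o (b o c). *)
Lemma lambdaM (B : groupType) (add : B -> B -> B) :
  left_cancellative_left_semi_brace add ->
  forall a b c, lambda add (a * b) c = lambda add a (lambda add b c).
Proof.
move=> HB a b c; apply: (HB.2 (a * b)); rewrite -(mulg_addE HB).
rewrite {2}(mulg_addE HB a b) -(left_semi_brace_addA HB.1) -(lambdaD HB.1).
by rewrite -!(mulg_addE HB) mulgA.
Qed.

Lemma lambdaK (B : groupType) (add : B -> B -> B) :
  left_cancellative_left_semi_brace add ->
  forall a, cancel (lambda add a) (lambda add a^-1).
Proof. by move=> HB a b; rewrite -(lambdaM HB) mulVg (lambda1 HB). Qed.

Lemma lambdaVK (B : groupType) (add : B -> B -> B) :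
  left_cancellative_left_semi_brace add ->
  forall a, cancel (lambda add a^-1) (lambda add a).
Proof. by move=> HB a b; rewrite -(lambdaM HB) mulgV (lambda1 HB). Qed.

(** * Additive idempotents and the kernel of the action on them *)

Lemma idempotent_addx (B : groupType) (add : B -> B -> B) (e : B) :
  left_cancellative_left_semi_brace add ->
  additive_idempotents add e -> forall x, add e x = x.
Proof.
by move=> HB Ee x; apply: (HB.2 e); rewrite (left_semi_brace_addA HB.1) Ee.
Qed.

Lemma idempotent1 (B : groupType) (add : B -> B -> B) :
  left_cancellative_left_semi_brace add -> additive_idempotents add 1.
Proof. by move=> HB; exact: add1x. Qed.

Lemma lambda_idempotent (B : groupType) (add : B -> B -> B) (a e : B) :
  left_semi_brace add ->
  additive_idempotents add e -> additive_idempotents add (lambda add a e).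
Proof. by move=> HB Ee; rewrite /additive_idempotents /= -(lambdaD HB) Ee. Qed.

Lemma idempotent_mulg (B : groupType) (add : B -> B -> B) (e : B) :
  left_cancellative_left_semi_brace add ->
  additive_idempotents add e -> forall x, e * x = lambda add e x.
Proof. by move=> HB Ee x; rewrite (mulg_addE HB) (idempotent_addx HB Ee). Qed.

Lemma idempotentV (B : groupType) (add : B -> B -> B) (e : B) :
  left_cancellative_left_semi_brace add ->
  additive_idempotents add e -> additive_idempotents add e^-1.
Proof.
(* Since lambda_e is left multiplication by e, e^- is the image of e o e^- = 1 under the inverse of
   lambda_e, and 1 is idempotent. *)
move=> HB Ee; rewrite -(lambdaK HB e e^-1) -(idempotent_mulg HB Ee) mulgV.
exact/(lambda_idempotent _ HB.1)/idempotent1.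
Qed.

Lemma subgroupI (B : groupType) (D : set B) :
  D 1 -> {in D, forall a, a^-1 \in D} -> {in D &, forall a b, a * b \in D} ->
  subgroup D.
Proof.
by move=> D1 DV DM; split=> [|a b Da Db]; [rewrite inE | apply/DM/DV].
Qed.

Lemma idempotents_subgroup (B : groupType) (add : B -> B -> B) :
  left_cancellative_left_semi_brace add -> subgroup (additive_idempotents add).
Proof.
move=> HB; apply: subgroupI; first exact: idempotent1.
  by move=> e; rewrite !inE; exact: idempotentV.
move=> e f; rewrite !inE => Ee Ef; rewrite (idempotent_mulg HB Ee).
exact: (lambda_idempotent _ HB.1).
Qed.

Lemma ker_lambda_idem_normal (B : groupType) (add : B -> B -> B) :
  left_cancellative_left_semi_brace add ->
  normal_subgroup (ker_lambda_idem add).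
Proof.
move=> HB; split; [apply: subgroupI|].
- by move=> e _; exact: lambda1.
- move=> a; rewrite !inE => Ka e Ee.
  by rewrite -[e in LHS]Ka // lambdaK.
- move=> a b; rewrite !inE => Ka Kb e Ee.
  by rewrite (lambdaM HB) Kb ?Ka.
- move=> a; rewrite inE => Ka b; rewrite inE => e Ee.
  (* The element a fixes the image of e under [lambda] of b^-, because that image is again
     idempotent. *)
  rewrite !(lambdaM HB) Ka ?lambdaVK //.
  by rewrite !inE in Ee *; exact: (lambda_idempotent _ HB.1).
Qed.

(** * The additive group G = B + 1 *)

Lemma right_zero_translatesP (B : groupType) (add : B -> B -> B) :
  left_cancellative_left_semi_brace add ->
  forall g, right_zero_translates add g <-> add g 1 = g.
Proof.
move=> HB g; split=> [[b _ <-]|<-]; last by exists g.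
by rewrite -(left_semi_brace_addA HB.1) (add1x HB).
Qed.

Lemma right_zero_translates_group (B : groupType) (add : B -> B -> B) :
  left_cancellative_left_semi_brace add ->
  additive_group_on (right_zero_translates add) add.
Proof.
move=> HB; pose addA := left_semi_brace_addA HB.1.
have GP := right_zero_translatesP HB.
(* The opposite of b comes from b + lambda_b(b^-) = b o b^- = 1; the final + 1 moves it into G. *)
have addV b : add b (add (lambda add b b^-1) 1) = 1.
  by rewrite addA -(mulg_addE HB) mulgV (add1x HB).
exists 1, (fun b => add (lambda add b b^-1) 1); split.
- by rewrite inE; apply/GP/(add1x HB).
- by move=> b _; rewrite inE; exists (lambda add b b^-1).
- by move=> a b; rewrite !inE !GP => _ Gb; rewrite -addA Gb.
split=> [a b c _ _ _ | a | a]; first exact: addA.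
  by rewrite inE GP => Ga; rewrite (add1x HB).
(* The right inverse is also a left one: a + (-a + a) = 1 + a = a = a + 1, then cancel a. *)
rewrite inE GP => Ga; split=> //; apply: (HB.2 a).
by rewrite addA addV (add1x HB).
Qed.

Lemma lambda_1_idempotent (B : groupType) (add : B -> B -> B) (b : B) :
  left_cancellative_left_semi_brace add ->
  additive_idempotents add (lambda add b 1).
Proof. by move=> HB; apply/(lambda_idempotent _ HB.1)/idempotent1. Qed.

Lemma left_semi_brace_onW (B : groupType) (D : set B) (add : B -> B -> B) :
  left_semi_brace add -> subgroup D -> {in D &, forall a b, add a b \in D} ->
  left_semi_brace_on D add.
Proof.
move=> HB sD cD; split=> // a b c _ _ _; first exact: left_semi_brace_addA.
exact: left_semi_brace_distr.
Qed.

(** * Conjugation on G and the semidirect decomposition *)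

Lemma conjg_automorphism (B : groupType) (N : set B) (b : B) :
  normal_subgroup N -> automorphism_on N *%g (fun g => b * g * b^-1).
Proof.
move=> [_ nN]; split; last by move=> x y _ _ /=; rewrite !mulgA mulgVK.
split=> [g /mem_set Ng | g h _ _ /mulIg /mulgI // | g /mem_set Ng].
  exact/set_mem/nN.
exists (b^-1 * g * b); last by rewrite !mulgA mulgV mul1g mulgK.
by have /set_mem := nN _ Ng b^-1; rewrite invgK.
Qed.

Lemma ker_lambda_mulg_idem (B : groupType) (add : B -> B -> B) (g e : B) :
  left_cancellative_left_semi_brace add -> ker_lambda_idem add g ->
  additive_idempotents add e -> g * e = add g e.
Proof.
by move=> HB Kg Ee; rewrite (mulg_addE HB) Kg // inE.
Qed.

(** By normality g' = e o g o e^- stays in the kernel, so lambda_e(g) = e o g = g' o e = g' + e.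
    Adding 1 on the right absorbs e, and g' + 1 = g' because g' is in G. *)
Lemma conjg_idempotentE (B : groupType) (add : B -> B -> B) (e g : B) :
  left_cancellative_left_semi_brace add ->
  right_zero_translates add = ker_lambda_idem add ->
  additive_idempotents add e -> right_zero_translates add g ->
  e * g * e^-1 = add (lambda add e g) 1.
Proof.
move=> HB GK Ee Gg; set g' := e * g * e^-1.
have Kg' : ker_lambda_idem add g'.
  apply/set_mem/(ker_lambda_idem_normal HB).2.
  by rewrite inE -GK.
have Gg' : add g' 1 = g' by apply/(right_zero_translatesP HB); rewrite GK.
rewrite -(idempotent_mulg HB Ee) -(mulgVK e (e * g)) -/g'.
rewrite (ker_lambda_mulg_idem HB Kg' Ee) -(left_semi_brace_addA HB.1).
by rewrite (idempotent_addx HB Ee).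
Qed.

Lemma conjg_idempotent_additive (B : groupType) (add : B -> B -> B) (e : B) :
  left_cancellative_left_semi_brace add ->
  right_zero_translates add = ker_lambda_idem add ->
  additive_idempotents add e ->
  automorphism_on (right_zero_translates add) add (fun g => e * g * e^-1).
Proof.
move=> HB GK Ee; split.
  by rewrite GK; case: (conjg_automorphism e (ker_lambda_idem_normal HB)).
pose addA := left_semi_brace_addA HB.1.
move=> x y; rewrite !inE => Gx Gy /=.
have Gxy : right_zero_translates add (add x y).
  move: Gx Gy; rewrite !(right_zero_translatesP HB) => _ Gy.
  by rewrite -addA Gy.
(* The 1 left between the two summands disappears, being a left identity. *)
rewrite !(conjg_idempotentE HB GK Ee) // (lambdaD HB.1) -!addA.
by rewrite (add1x HB).
Qed.

Lemma right_zero_translates_semidirect (B : groupType) (add : B -> B -> B) :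
  left_cancellative_left_semi_brace add ->
  right_zero_translates add = ker_lambda_idem add ->
  internal_semidirect_product (right_zero_translates add)
    (additive_idempotents add).
Proof.
move=> HB GK; have GP := right_zero_translatesP HB; split.
- by rewrite GK; exact: ker_lambda_idem_normal.
- exact: idempotents_subgroup.
(* An idempotent g of G satisfies g = g + 1 = 1, as g is a left identity. *)
- rewrite eqEsubset; split=> [g [/GP Gg Eg] | _ ->] /=.
    by rewrite -Gg (idempotent_addx HB Eg).
  by split; [apply/GP/(add1x HB) | exact: idempotent1].
rewrite -subTset => b _ /=; have El := lambda_1_idempotent b HB.
have Gb : right_zero_translates add (add b 1) by exists b.
exists (add b 1) => //; exists (lambda add b 1) => //.
rewrite (ker_lambda_mulg_idem HB _ El) -?GK //.
by rewrite -(left_semi_brace_addA HB.1) (add1x HB) -(mulg_addE HB) mulg1.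
Qed.

(** * From skew left braces to semi-braces on semidirect products *)

Lemma additive_group_cancel (B : Type) (add : B -> B -> B) :
  additive_group_on [set: B] add -> right_injective add.
Proof.
case=> zero [opp [_ _ _ [A Z V]]] a b c eq_bc.
have inT (x : B) : x \in [set: B] by rewrite inE.
have oppK x : add (opp a) (add a x) = x.
  by rewrite A // (V a (inT a)).1 (Z x (inT x)).1.
by rewrite -(oppK b) eq_bc oppK.
Qed.

Lemma skew_left_brace_cancellative (B : groupType) (add : B -> B -> B) :
  skew_left_brace add -> left_cancellative_left_semi_brace add.
Proof. by case=> HB /additive_group_cancel. Qed.

Lemma skew_left_brace_addx1 (B : groupType) (add : B -> B -> B) :
  skew_left_brace add -> right_id 1 add.
Proof.
move=> HB; have HC := skew_left_brace_cancellative HB.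
case: HB => _ [zero [opp [_ _ _ [_ Z _]]]] x.
have inT (y : B) : y \in [set: B] by rewrite inE.
(* The two neutral elements coincide by evaluating 1 + [zero] in both ways. *)
suff -> : 1 = zero by exact: (Z x (inT x)).2.
by rewrite -(add1x HC zero) (Z 1 (inT 1)).2.
Qed.

(** The direct product of (H, +) with the right-zero semigroup on F, in which every element is
    idempotent. *)
Definition semidirect_add (F H : groupType) (beta : aut_hom F H)
    (addH : H -> H -> H) (a b : semidirect beta) : semidirect beta :=
  (addH a.1 b.1, b.2).

Lemma semidirect_left_semi_brace (F H : groupType) (beta : aut_hom F H)
    (addH : H -> H -> H) :
  left_cancellative_left_semi_brace addH ->
  (forall f, {morph beta f : x y / addH x y}) ->
  left_cancellative_left_semi_brace (@semidirect_add F H beta addH).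
Proof.
move=> HC betaD; split; last first.
  by move=> [h f] [h1 f1] [h2 f2] [/HC.2 -> ->].
split; first by apply: subgroupI => // *; rewrite inE.
- by move=> *; rewrite inE.
- move=> [h f] [h1 f1] [h2 f2] _ _ _; congr (_, _) => /=.
  exact: left_semi_brace_addA HC.1 _ _ _.
- move=> [h f] [h1 f1] [h2 f2] _ _ _; congr (_, _) => /=.
  (* The inverse of (h, f) has first coordinate h^- twisted by [beta f^-1]; applying [beta f] undoes
     the twist and leaves distributivity in H. *)
  rewrite !betaD (left_semi_brace_distr HC.1) -aut_funM mulgV.
  by rewrite aut_hom1.
Qed.

(** The second coordinate is moved by left translation, so an element that fixes even one pair has
    trivial F-part; this computes the kernel. *)
Lemma semidirect_lambda (F H : groupType) (beta : aut_hom F H)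
    (addH : H -> H -> H) :
  (forall f, {morph beta f : x y / addH x y}) ->
  forall a b : semidirect beta,
  lambda (@semidirect_add F H beta addH) a b =
    (lambda addH a.1 (beta a.2 b.1), a.2 * b.2).
Proof.
move=> betaD [h f] [h1 f1]; congr (_, _) => /=.
by rewrite betaD -aut_funM mulgV aut_hom1.
Qed.

Theorem corollary3p4 :
  (forall (B : groupType) (add : B -> B -> B),
     left_cancellative_left_semi_brace add ->
     let G := right_zero_translates add in
     let E := additive_idempotents add in
     G = ker_lambda_idem add ->
     [/\ skew_left_brace_on G add,
         normal_subgroup G,
         G `&` E = [set 1],
         (forall e : B, E e ->
            automorphism_on G *%g (fun g => e * g * e^-1) /\
            automorphism_on G add (fun g => e * g * e^-1))
       & internal_semidirect_product G E])
  /\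
  (forall (H F : groupType) (beta : aut_hom F H) (addH : H -> H -> H),
     skew_left_brace addH ->
     (forall f : F, automorphism addH (beta f) /\ automorphism *%g (beta f)) ->
     exists add : semidirect beta -> semidirect beta -> semidirect beta,
       [/\ left_cancellative_left_semi_brace add,
           (forall h1 h2 : H, add (h1, 1) (h2, 1) = (addH h1 h2, 1)),
           additive_idempotents add = [set 1] `*` [set: F]
         & ker_lambda_idem add = [set: H] `*` [set 1]]).
Proof.
split=> [B add HB G E GK | H F beta addH Hs betaA].
  have nG : normal_subgroup G by rewrite GK; exact: ker_lambda_idem_normal.
  have [_ _ GE _] := right_zero_translates_semidirect HB GK.
  split=> //; last exact: right_zero_translates_semidirect.
    have addG := right_zero_translates_group HB; split=> //.
    by case: addG => ? [? [_ _ ? _]]; exact: left_semi_brace_onW HB.1 nG.1 _.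
  move=> e Ee; split; first exact: conjg_automorphism.
  exact: conjg_idempotent_additive.
have HC := skew_left_brace_cancellative Hs.
have betaD f : {morph beta f : x y / addH x y}.
  by move=> x y; case: (betaA f) => -[_ + _]; apply; rewrite inE.
have idE : additive_idempotents (@semidirect_add F H beta addH) =
    [set 1] `*` [set: F].
  rewrite eqEsubset; split=> [[h f] [hh] | [h f] [/= -> _]].
    (* In H, h + h = h = h + 1 forces h = 1. *)
    by split=> //=; apply: (HC.2 h); rewrite hh skew_left_brace_addx1.
  by congr (_, _); exact: add1x.
exists (@semidirect_add F H beta addH); split=> //.
  exact: semidirect_left_semi_brace.
(* Hence the H-part acts trivially on idempotents, whose first coordinate is 1. *)
have lam1 h : lambda addH h 1 = 1.
  by rewrite /lambda skew_left_brace_addx1 // mulgV.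
rewrite eqEsubset; split=> [[h f] K | [h f] [_ /= ->] e].
  (* Testing the kernel condition on the neutral pair alone gives f o 1 = 1. *)
  split=> //=; have /K : (1, 1) \in additive_idempotents
    (@semidirect_add F H beta addH) by rewrite idE inE.
  by rewrite (semidirect_lambda betaD) => -[_]; rewrite mulg1.
rewrite idE inE => -[e1 _]; rewrite (semidirect_lambda betaD) /= e1.
by rewrite aut_hom_one lam1 mul1g -e1 -surjective_pairing.
Qed.
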